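(* Let $H$ be a countably infinite graph, $W\subseteq V(H)$ nonempty and $k\in\mathbb{N}$. Suppose there are subsets $W_0,\dots,W_k$ of $V(H)$ such that $W_0=W$ and for each $j<k$ and each finite $F\subseteq\bigcup_{i\le j}W_i$ the set $W_{j+1}\cap N_H[F]$ is infinite. Then Bob has a winning strategy in the game $G(H,W,k)$.
   Context: For $F\subseteq V(H)$, $N_H[F]=\{w\in V(H): \{v,w\}\in E(H)\text{ for all } v\in F\}$ (so $N_H[\emptyset]=V(H)$). The game $G(H,W,k)$ is played by Adam and Bob, who alternately choose pairwise disjoint finite subsets $A_0,B_0,A_1,B_1,\dots$ of $V(H)$ (Adam chooses the $A_i$, Bob the $B_i$). Bob wins iff (A) $W\subseteq\bigcup_{i\in\mathbb{N}}(A_i\cup B_i)$, and (B) the induced subgraph $H[\bigcup_i B_i]$ contains the $k^{th}$ power of a (finite or one-way infinite) Hamiltonian path, i.e. $\bigcup_iB_i$ can be enumerated as a finite or one-way infinite sequence $v_0,v_1,\dots$ of distinct vertices with $\{v_i,v_j\}\in E(H)$ whenever $1\le|i-j|\le k$. *)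

(* Defs.v *)
From mathcomp Require Export all_boot finmap.
From mathcomp Require Export boolp classical_sets functions cardinality.

Set Implicit Arguments.
Unset Strict Implicit.
Unset Printing Implicit Defensive.

Local Open Scope classical_set_scope.

Record sgraph (V : Type) := SGraph {
  adj :> V -> V -> Prop;
  adj_sym : forall x y, adj x y -> adj y x;
  adj_irrefl : forall x, ~ adj x x }.

Definition common_nbrs (V : Type) (H : sgraph V) (F : set V) : set V :=
  [set w | forall v, F v -> H v w].

(* A path has at least one vertex, hence the finite index sets {0, ..., n}.
   Only pairs i < j are listed, adjacency being symmetric. *)
Definition spanned_by_path_power (V : Type) (H : sgraph V) (k : nat)
    (U : set V) : Prop :=
  exists (D : set nat) (v : nat -> V),
    [/\ D = [set: nat] \/ (exists n, D = [set i | (i <= n)%N]),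
        set_bij D U v &
        forall i j, D i -> D j -> (i < j <= i + k)%N -> H (v i) (v j)].

Section Game.
Variable V : countType.
Implicit Types A B : nat -> {fset V}.

(* The order of play is A 0, B 0, A 1, B 1, and so on; a move must avoid
   everything chosen before it. Empty moves are allowed. *)
Definition adam_legal A B (n : nat) : Prop :=
  forall i, (i < n)%N -> [disjoint A n & A i]%fset /\ [disjoint A n & B i]%fset.

Definition bob_legal A B (n : nat) : Prop :=
  (forall i, (i <= n)%N -> [disjoint B n & A i]%fset) /\
  (forall i, (i < n)%N -> [disjoint B n & B i]%fset).

Definition bob_wins (H : sgraph V) (W : set V) (k : nat) A B : Prop :=
  W `<=` \bigcup_i ([set` A i] `|` [set` B i]) /\
  spanned_by_path_power H k (\bigcup_i [set` B i]).

(* The arguments are Adam's moves so far and Bob's moves so far. *)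
Definition bob_strategy := seq {fset V} -> seq {fset V} -> {fset V}.

Definition follows (sigma : bob_strategy) A B : Prop :=
  forall n, B n = sigma (mkseq A n.+1) (mkseq B n).

(* Bob must not be the first to break the rules, and must win every play in
   which Adam respects them. *)
Definition winning_for_bob (H : sgraph V) (W : set V) (k : nat)
    (sigma : bob_strategy) : Prop :=
  forall A B, follows sigma A B ->
    (forall n, (forall i, (i <= n)%N -> adam_legal A B i) -> bob_legal A B n) /\
    ((forall n, adam_legal A B n) -> bob_wins H W k A B).

End Game.

(* Main.v *)
(** Positions p of the path are written p = m (k+1) + j with j <= k, and v_p is
   to lie in W_j. Within distance k of each other two positions have different
   residues j; the one of higher residue is filled later, and it is then chosen
   adjacent to the finitely many vertices of lower residue already present.
   Bob's move number t puts the first vertex of W not used so far (in a fixed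
   enumeration of V) at position t (k+1), and then fills the positions with
   m + j = t, j = 1, ..., k, in that order. Filling is delayed along these
   diagonals because position m (k+1) + j has neighbours of lower residue both
   in block m and in block m + 1. Once W is exhausted, Bob fills the remaining
   positions up to the last vertex of W he placed (or plays a single vertex if
   he placed none), and from then on makes empty moves. *)
Require Import Defs.
From mathcomp Require Import zify.

Set Implicit Arguments.
Unset Strict Implicit.
Unset Printing Implicit Defensive.

Local Open Scope classical_set_scope.

(** * Fresh elements, least codes and initial segments of the naturals *)

Lemma infinite_set_fresh (T : choiceType) (X : set T) (U : {fset T}) :
  infinite_set X -> exists2 x, X x & x \notin U.
Proof.
move=> /infinite_setD/(_ (finite_fset U))/infinite_setN0[x [Xx Ux]].
by exists x => //; apply/negP.
Qed.

Lemma exists_min_pickle (T : countType) (X : set T) : X !=set0 ->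
  exists2 x, X x & forall y, X y -> choice.pickle x <= choice.pickle y.
Proof.
move=> [x0 Xx0]; pose P n := `[< exists2 x, X x & choice.pickle x = n >].
have exP : exists n, P n by exists (choice.pickle x0); apply/asboolP; exists x0.
have [n /asboolP[x Xx <-] min_x] := ex_minnP exP.
by exists x => // y Xy; apply: min_x; apply/asboolP; exists y.
Qed.

Lemma in_fset_leq (P : pred nat) (n p : nat) :
  (p \in [fset q in iota 0 n.+1 | P q]%fset) = (p <= n) && P p.
Proof. by rewrite !inE; congr andb; rewrite -[LHS]/(p \in iota 0 n.+1) mem_iota. Qed.

Lemma down_closed_nat (D : set nat) : D 0 ->
    (forall p q, q <= p -> D p -> D q) ->
  D = [set: nat] \/ exists n, D = [set i | i <= n].
Proof.
move=> D0 downD; have [[p NDp]|allD] := pselect (exists p, ~ D p); last first.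
  by left; apply/seteqP; split=> // p _; apply: contrapT => NDp; apply: allD; exists p.
right; have exN : exists p, `[< ~ D p >] by exists p; apply/asboolP.
have [[|n] /asboolP ND min_n] := ex_minnP exN; first by case: ND.
exists n; apply/seteqP; split=> q /= => [Dq|le_qn].
  by rewrite leqNgt; apply/negP => lt_nq; apply: ND; apply: downD Dq.
apply: contrapT => NDq; have := min_n q; rewrite leqNgt ltnS le_qn => /implyP.
by rewrite implybF => /negP; apply; apply/asboolP.
Qed.

(** * Residues, diagonals and nearness of path positions *)

Section Positions.
Variable k : nat.
Implicit Types p q : nat.

(* Position p of the path is to be filled by a vertex of Ws (p %% k.+1), in
   Bob's move number lay p, or earlier if W is exhausted before. *)
Definition typ p := p %% k.+1.
Definition lay p := p %/ k.+1 + p %% k.+1.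

Definition near p q := (p < q <= p + k) || (q < p <= q + k).

Lemma near_typ_neq p q : near p q -> typ p != typ q.
Proof.
have ptyp x y : x < y <= x + k -> typ x != typ y.
  move=> /andP[lt_xy le_y]; apply/eqP => eq_xy.
  have : k.+1 %| y - x by rewrite -eqn_mod_dvd ?(ltnW lt_xy)//; apply/eqP.
  by move/dvdn_leq; lia.
by case/orP=> /ptyp; rewrite // eq_sym.
Qed.

(** Near positions lie in the same block or in consecutive ones, and a strictly larger residue makes
    up for a block number smaller by one. Hence, of two near positions on different diagonals, the
    later diagonal holds the larger residue. *)
Lemma near_lay p q : near p q -> typ p < typ q -> lay p <= lay q.
Proof.
rewrite /near /lay /typ => + ltpq.
have := ltn_pmod q (ltn0Sn k).
have := divn_eq p k.+1; have := divn_eq q k.+1.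
move: (p %/ _) (q %/ _) (p %% _) (q %% _) ltpq => m m' i j lt_ij.
move=> -> -> lt_jk nearpq.
suff : m <= m'.+1 by lia.
rewrite leqNgt; apply/negP => lt_mm.
have : m'.+2 * k.+1 <= m * k.+1 by rewrite leq_mul2r lt_mm orbT.
by rewrite !mulSn; lia.
Qed.

Lemma typ_mul m : typ (m * k.+1) = 0.
Proof. by rewrite /typ modnMl. Qed.

Lemma lay_mul m : lay (m * k.+1) = m.
Proof. by rewrite /lay modnMl mulnK// addn0. Qed.

Lemma typ0_lay p : typ p = 0 -> p = lay p * k.+1.
Proof. by rewrite /typ /lay => t0; rewrite [LHS](divn_eq p k.+1) t0 !addn0. Qed.

Lemma leq_lay p : p <= lay p * k.+1.
Proof. by rewrite {1}(divn_eq p k.+1) /lay mulnDl leq_add2l leq_pmulr. Qed.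

End Positions.

(** * Extending finite partial paths *)

Section Bob.
Variables (V : countType) (H : sgraph V) (W : set V) (k : nat).
Variables (Ws : nat -> set V).
Hypothesis V_infinite : infinite_set [set: V].
Hypothesis Ws0 : Ws 0 = W.
Hypothesis Ws_infinite : forall j : nat, j < k -> forall F : {fset V},
  [set` F] `<=` \bigcup_(i in [set i : nat | i <= j]) Ws i ->
  infinite_set (Ws j.+1 `&` common_nbrs H [set` F]).

Notation typ := (typ k).
Notation lay := (lay k).
Notation near := (near k).

Implicit Types (D E : {fset nat}) (c : nat -> V) (U A : {fset V}).

(** [D] holds the positions filled so far; [c] is total, and its values outside [D] mean nothing. *)
Definition good D c :=
  {in D &, injective c} /\
  {in D &, forall p q, p < q <= p + k -> H (c p) (c q)}.

Definition typed D c := {in D, forall p, Ws (typ p) (c p)}.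

Definition extends U D c D' c' :=
  [/\ {subset D <= D'}, {in D, c' =1 c} &
      forall p, p \in D' -> p \notin D -> c' p \notin U].

Lemma extends_trans U D1 c1 D2 c2 D3 c3 :
  extends U D1 c1 D2 c2 -> extends U D2 c2 D3 c3 -> extends U D1 c1 D3 c3.
Proof.
move=> [s12 e12 f12] [s23 e23 f23]; split.
- by move=> p /s12/s23.
- by move=> p D1p; rewrite e23 ?s12// e12.
- move=> p D3p ND1p; have [D2p|ND2p] := boolP (p \in D2); last exact: f23.
  by rewrite e23// f12.
Qed.

Definition upd c p v := fun q => if q == p then v else c q.

Lemma add_vertex D c U p v : good D c -> p \notin D -> v \notin U ->
    {in D, forall q, v <> c q} ->
    {in D, forall q, near p q -> H (c q) v} ->
  good (p |` D)%fset (upd c p v) /\ extends U D c (p |` D)%fset (upd c p v).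
Proof.
move=> [injc adjc] NDp Uv newv adjv.
have updD : {in D, upd c p v =1 c}.
  by move=> q Dq; rewrite /upd; case: eqP => // eqp; rewrite -eqp Dq in NDp.
have updp : upd c p v p = v by rewrite /upd eqxx.
split; split.
- move=> q r; rewrite !in_fset1U => /predU1P[->|Dq] /predU1P[->|Dr] //.
  + by rewrite updp updD// => /newv; case.
  + by rewrite updp updD// => /esym/newv; case.
  + by rewrite !updD//; apply: injc.
- move=> q r; rewrite !in_fset1U => /predU1P[->|Dq] /predU1P[->|Dr] qr.
  + by move: qr; rewrite ltnn.
  + by rewrite updp updD//; apply/adj_sym/adjv => //; rewrite /near qr.
  + by rewrite updp updD//; apply/adjv => //; rewrite /near qr orbT.
  + by rewrite !updD//; apply: adjc.
- by move=> q Dq; rewrite in_fset1U Dq orbT.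
- exact: updD.
- by move=> q; rewrite in_fset1U => /predU1P[-> _|->//]; rewrite updp.
Qed.

Lemma typed_upd D c p v :
  typed D c -> Ws (typ p) v -> typed (p |` D)%fset (upd c p v).
Proof.
move=> typc Wv q; rewrite in_fset1U /upd; case: eqP => [->//|_] /=.
exact: typc.
Qed.

(** The filled positions near [p] carry vertices of sets [Ws i] with [i < typ p], so infinitely many
    vertices of [Ws (typ p)] are adjacent to all of them; one avoids both [U] and the partial
    path. *)
Lemma fill_one D c U p : good D c -> typed D c -> p \notin D -> 0 < typ p ->
    {in D, forall q, near p q -> typ q < typ p} ->
  exists c', [/\ good (p |` D)%fset c', typed (p |` D)%fset c' &
                 extends U D c (p |` D)%fset c'].
Proof.
move=> goodc typc NDp typ_gt0 low.
have lt_k : (typ p).-1 < k.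
  by rewrite prednK//; have := ltn_pmod p (ltn0Sn k); rewrite ltnS.
pose F := [fset c q | q in [fset q in D | near p q]]%fset.
have sFW : [set` F] `<=` \bigcup_(i in [set i : nat | i <= (typ p).-1]) Ws i.
  move=> x /imfsetP[q /=]; rewrite !inE => /andP[Dq nearpq] ->.
  by exists (typ q); [rewrite /= -ltnS prednK// low|apply: typc].
have [v [Wv adjv]] :=
  infinite_set_fresh (U `|` [fset c q | q in D])%fset (Ws_infinite lt_k sFW).
rewrite inE negb_or => /andP[Uv newv]; rewrite prednK// in Wv.
have [||goodc' ext] := @add_vertex D c U p v goodc NDp Uv.
- by move=> q Dq eqv; rewrite eqv in_imfset in newv.
- move=> q Dq nearpq; apply/adj_sym/adj_sym/adjv => /=.
  by apply/imfsetP; exists q; rewrite //= !inE Dq.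
by exists (upd c p v); split=> //; apply: typed_upd.
Qed.

(** The positions of [E] are added in order of residue. Near positions have different residues, so
    those of [E] already present near the next one have smaller residue, as [fill_one] requires. *)
Lemma fill D c U E : good D c -> typed D c -> {in E, forall p, 0 < typ p} ->
    {in E & D, forall p q, p <> q /\ (near p q -> typ q < typ p)} ->
  exists c', [/\ good (E `|` D)%fset c', typed (E `|` D)%fset c' &
                 extends U D c (E `|` D)%fset c'].
Proof.
move=> goodc typc; pose le_typ := relpre typ leq.
have [s [uniq_s mem_s sorted_s]] :
    exists s, [/\ uniq s, s =i E & pairwise le_typ s].
  exists (sort le_typ (enum_fset E)); split; first by rewrite sort_uniq fset_uniq.
    exact: mem_sort.
  rewrite -sorted_pairwise ?sort_sorted// => [p q|p q r]; first exact: leq_total.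
  exact: leq_trans.
elim/last_ind: s E uniq_s mem_s sorted_s => [|s p IHs] E uniq_s mem_s sorted_s pos low.
  have -> : E = fset0 by apply/fsetP => x; rewrite -mem_s.
  by exists c; rewrite fset0U; split=> //; split=> // q ->.
move: uniq_s sorted_s; rewrite rcons_uniq pairwise_rcons.
move=> /andP[Nsp uniq_s] /andP[/allP le_p sorted_s].
have Ep : p \in E by rewrite -mem_s mem_rcons mem_head.
have mem_s' : s =i (E `\ p)%fset.
  move=> q; rewrite !inE -mem_s mem_rcons in_cons; case: eqP => [->|]//=.
  exact/negbTE.
have [||c1 [good1 typ1 ext1]] := IHs (E `\ p)%fset uniq_s mem_s' sorted_s.
- by move=> q; rewrite !inE => /andP[_ /pos].
- by move=> q r; rewrite !inE => /andP[_ Eq]; apply: low.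
have eqED : (p |` (E `\ p `|` D) = E `|` D)%fset.
  by rewrite fsetUA fsetD1K.
have [|||c2] := @fill_one (E `\ p `|` D)%fset c1 U p good1 typ1.
- by rewrite !inE eqxx /=; apply/negP => Dp; have [] := low _ _ Ep Dp.
- exact: pos.
- move=> q /fsetUP[|Dq]; last exact: (low p q Ep Dq).2.
  rewrite -mem_s' => sq /near_typ_neq neq.
  by rewrite ltn_neqAle eq_sym neq; apply: le_p.
rewrite eqED => -[good2 typ2 ext2].
by exists c2; split=> //; apply: extends_trans ext1 ext2.
Qed.

(** * States of the game and a single round *)

Record state := State
  { time : nat; dom : {fset nat}; val : nat -> V; used : {fset V} }.

Definition start c := State 0 fset0 c fset0.

(** The number of rounds bounds both the filled diagonals and the codes of the vertices of [W]
    guaranteed to be used. *)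
Definition active s :=
  [/\ forall p, (p \in dom s) = (lay p < time s),
      forall w, W w -> choice.pickle w < time s -> w \in used s &
      typed (dom s) (val s)].

Definition finished s :=
  W `<=` [set` used s] /\ exists N, forall p, (p \in dom s) = (p <= N).

Definition inv s :=
  [/\ good (dom s) (val s), {in dom s, forall p, val s p \in used s} &
      active s \/ finished s].

Definition move s s' : {fset V} := [fset val s' p | p in (dom s' `\` dom s)%fset]%fset.

Definition step s A s' :=
  [/\ time s' = (time s).+1, used s' = (used s `|` A `|` move s s')%fset &
      extends (used s `|` A)%fset (dom s) (val s) (dom s') (val s')].

Lemma next_state s A D c : {in dom s, forall p, val s p \in used s} ->
    good D c -> extends (used s `|` A)%fset (dom s) (val s) D c ->
  exists s', [/\ step s A s', dom s' = D, val s' = c, good D c &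
    {in D, forall p, c p \in used s'}].
Proof.
move=> us goodc [sD eqc fresh].
exists (State (time s).+1 D c
  (used s `|` A `|` [fset c p | p in (D `\` dom s)%fset])%fset).
split=> // p Dp /=; rewrite !in_fsetU.
have [sp|Nsp] := boolP (p \in dom s); first by rewrite eqc// us.
by rewrite in_imfset ?orbT//= inE Nsp.
Qed.

Lemma step_active s A : good (dom s) (val s) ->
    {in dom s, forall p, val s p \in used s} -> active s ->
    (W `\` [set` (used s `|` A)%fset]) !=set0 ->
  exists s', inv s' /\ step s A s'.
Proof.
set t := time s => goods us [domE covers typs].
case/exists_min_pickle => w [Ww /negP NUw] min_w.
pose p0 := t * k.+1.
have typ_p0 : typ p0 = 0 by rewrite typ_mul.
have lay_p0 : lay p0 = t by rewrite lay_mul.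
(* This is [near_lay] read backwards: a position on diagonal [t] or later has larger residue than
   any filled position near it. *)
have low : forall p q, t <= lay p -> q \in dom s ->
    p <> q /\ (near p q -> typ q < typ p).
  move=> p q le_t; rewrite domE => lt_t; split.
    by move=> eqpq; rewrite eqpq leqNgt lt_t in le_t.
  move=> nearpq; rewrite ltn_neqAle eq_sym near_typ_neq//= leqNgt.
  apply/negP => ltpq; have le_lay := near_lay nearpq ltpq.
  by have := leq_ltn_trans (leq_trans le_t le_lay) lt_t; rewrite ltnn.
have ND0 : p0 \notin dom s by rewrite domE lay_p0 ltnn.
(* As [p0] has residue 0, [low] shows that no filled position is near it, so [w] has no adjacency to
   satisfy. *)
have [||good1 ext1] := add_vertex goods ND0 NUw.
- move=> q /us + eqw; rewrite -eqw => usw.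
  by rewrite inE usw in NUw.
- move=> q Dq nearq; have [|_ /(_ nearq)] := low p0 q _ Dq; first by rewrite lay_p0.
  by rewrite typ_p0.
have typ1 : typed (p0 |` dom s)%fset (upd (val s) p0 w).
  by apply: typed_upd => //; rewrite typ_p0 Ws0.
(* The rest of diagonal [t], which by [leq_lay] does not reach beyond [p0]. *)
pose E := [fset p in iota 0 p0.+1 | (lay p == t) && (0 < typ p)]%fset.
have EE p : (p \in E) = (lay p == t) && (0 < typ p).
  rewrite in_fset_leq; case: eqP => [layp|]; last by rewrite andbF.
  by rewrite /p0 -{1}layp leq_lay.
have [||c2 [good2 typ2 ext2]] := fill (used s `|` A)%fset good1 typ1 (E := E).
- by move=> p; rewrite EE => /andP[].
- move=> p q; rewrite EE => /andP[/eqP layp typ_gt0].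
  rewrite in_fset1U => /predU1P[->|Dq]; last by apply: low; rewrite ?layp.
  by rewrite typ_p0; split=> // eqp; rewrite eqp typ_p0 in typ_gt0.
have ext := extends_trans ext1 ext2.
have [s' [steps doms vals good3 us']] := next_state us good2 ext.
exists s'; split=> //; split; rewrite ?doms ?vals//; left.
have [time' used' _] := steps.
split; last by rewrite doms vals.
  move=> p; rewrite doms time' ltnS leq_eqVlt in_fsetU EE in_fset1U domE.
  have [layp|Nlay] := eqVneq (lay p) t; last first.
    by case: (eqVneq p p0) Nlay => [->|]; rewrite ?lay_p0 ?eqxx.
  case: (posnP (typ p)) => //= /typ0_lay; rewrite layp => ->.
  by rewrite eqxx.
move=> v Wv; rewrite time' ltnS leq_eqVlt => /orP[/eqP pv|/covers]; last first.
  by move=> /(_ Wv); rewrite used' !in_fsetU => ->.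
have [Uv|NUv] := boolP (v \in (used s `|` A)%fset).
  by rewrite used' in_fsetU Uv.
have [|le_w] := leqP t (choice.pickle w).
  have := min_w v; rewrite pv => /(_ (conj Wv (negP NUv))) le_wt le_tw.
  have /(pcan_inj (@choice.pickleK V)) -> : choice.pickle v = choice.pickle w.
    by apply/eqP; rewrite pv eqn_leq le_tw le_wt.
  have [_ eq2 _] := ext2.
  have := us' p0; rewrite eq2 ?in_fset1U ?eqxx// /upd eqxx; apply.
  by rewrite in_fsetU in_fset1U eqxx orbT.
by have := covers _ Ww le_w => uw; rewrite inE uw in NUw.
Qed.

Lemma step_finish s A : good (dom s) (val s) ->
    {in dom s, forall p, val s p \in used s} -> active s ->
    W `<=` [set` (used s `|` A)%fset] ->
  exists s', inv s' /\ step s A s'.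
Proof.
set t := time s => goods us [domE covers typs] sW.
suff [N [D [c [DE goodc ext]]]] : exists N D c, [/\ forall p, (p \in D) = (p <= N),
    good D c & extends (used s `|` A)%fset (dom s) (val s) D c].
  have [s' [steps doms vals good3 us']] := next_state us goodc ext.
  have [_ used' _] := steps.
  exists s'; split=> //; split; rewrite ?doms ?vals//; right; split.
    by move=> w /sW /=; rewrite used' !in_fsetU => ->.
  by exists N => p; rewrite doms.
(* At time 0 no position is filled, as when Adam's first move takes all of [W]. A path needs a
   vertex, and any fresh one serves at position 0. *)
case: (posnP t) => [t0|t_gt0].
  have dom0 p : p \notin dom s by rewrite domE -/t t0.
  have [v _ NUv] := infinite_set_fresh (used s `|` A)%fset V_infinite.
  have [||goodc ext] := @add_vertex _ _ _ 0 v goods (dom0 0) NUv.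
  - by move=> q Dq; have := dom0 q; rewrite Dq.
  - by move=> q Dq; have := dom0 q; rewrite Dq.
  exists 0, (0 |` dom s)%fset, (upd (val s) 0 v); split=> // p.
  by rewrite in_fset1U (negbTE (dom0 p)) orbF leqn0.
(* The position of the last vertex of [W] that Bob placed. Positions of residue 0 up to [N] lie on
   diagonals below [t], so the gaps all have positive residue and [fill] applies. *)
pose N := t.-1 * k.+1.
have le_N p : p \in dom s -> p <= N.
  rewrite domE -/t => lt_t; apply: leq_trans (leq_lay k p) _.
  by rewrite leq_mul2r -ltnS prednK// lt_t orbT.
pose E := [fset p in iota 0 N.+1 | t <= lay p]%fset.
have EE p : (p \in E) = (p <= N) && (t <= lay p).
  by rewrite in_fset_leq.
have [||c [goodc _ ext]] := fill (used s `|` A)%fset goods typs (E := E).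
- move=> p; rewrite EE lt0n => /andP[le_pN le_t]; apply/eqP => /typ0_lay eqp.
  move: le_pN; rewrite eqp leq_mul2r /= => le_pred.
  by have := leq_trans le_t le_pred; rewrite leqNgt prednK// leqnn.
- move=> p q; rewrite EE => /andP[_ le_t]; rewrite domE => lt_t; split.
    by move=> eqpq; rewrite eqpq leqNgt lt_t in le_t.
  move=> nearpq; rewrite ltn_neqAle eq_sym near_typ_neq//= leqNgt.
  apply/negP => ltpq; have le_lay := near_lay nearpq ltpq.
  by have := leq_ltn_trans (leq_trans le_t le_lay) lt_t; rewrite ltnn.
exists N, (E `|` dom s)%fset, c; split=> // p; rewrite in_fsetU EE.
have [/le_N ->|] := boolP (p \in dom s); first by rewrite orbT.
by rewrite domE -leqNgt => ->; rewrite andbT orbF.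
Qed.

Lemma inv_step s A : inv s -> exists s', inv s' /\ step s A s'.
Proof.
move=> [goods us [act|[sW [N domE]]]].
  have [sW|] := pselect (W `<=` [set` (used s `|` A)%fset]).
    exact: step_finish.
  by move=> /nonsubset; rewrite -setDE; apply: step_active.
have ext : extends (used s `|` A)%fset (dom s) (val s) (dom s) (val s).
  by split=> // p ->.
have [s' [steps doms vals good' us']] := next_state us goods ext.
have [_ used' _] := steps.
exists s'; split=> //; split; rewrite ?doms ?vals//; right; split.
  by move=> w /sW /=; rewrite used' !in_fsetU => ->.
by exists N => p; rewrite doms.
Qed.

(** * A play along the states, and its limit *)

Section Play.
Variables (A B : nat -> {fset V}) (S : nat -> state) (c0 : nat -> V).
Hypothesis S0 : S 0 = start c0.
Hypothesis invS : forall n, inv (S n).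
Hypothesis stepS : forall n, step (S n) (A n) (S n.+1).
Hypothesis BE : forall n, B n = move (S n) (S n.+1).

Lemma timeE n : time (S n) = n.
Proof. by elim: n => [|n IHn]; [rewrite S0|have [-> _ _] := stepS n; rewrite IHn]. Qed.

Lemma usedP n x :
  reflect (exists2 i, i < n & (x \in A i) || (x \in B i)) (x \in used (S n)).
Proof.
elim: n => [|n IHn]; first by rewrite S0; apply: (iffP idP) => // -[].
have [_ -> _] := stepS n; rewrite !in_fsetU -BE -orbA.
apply: (iffP orP) => [[/IHn[i lt_in ABx]|ABx]|[i + ABx]].
- by exists i => //; apply: ltnW.
- by exists n.
- rewrite ltnS leq_eqVlt => /predU1P[<-|lt_in]; [by right|left].
  by apply/IHn; exists i.
Qed.

Lemma bob_legal_play n : bob_legal A B n.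
Proof.
have [_ _ [_ _ fresh]] := stepS n.
have {}fresh x : x \in B n -> x \notin (used (S n) `|` A n)%fset.
  by rewrite BE => /imfsetP[p /=]; rewrite inE => /andP[NDp Dp] ->; apply: fresh.
split=> i lt_in; apply/fdisjointP => x /fresh; rewrite inE negb_or => /andP[Nu NA].
  move: lt_in; rewrite leq_eqVlt => /predU1P[->//|lt_in].
  by apply: contra Nu => Aix; apply/usedP; exists i => //; rewrite Aix.
by apply: contra Nu => Bix; apply/usedP; exists i => //; rewrite Bix orbT.
Qed.

Lemma sub_dom m n : m <= n -> {subset dom (S m) <= dom (S n)}.
Proof.
move=> /subnK <-; elim: (n - m) => [//|d IHd] p /IHd.
by have [_ _ [sub _ _]] := stepS (d + m); apply: sub.
Qed.

Lemma val_dom m n p : m <= n -> p \in dom (S m) -> val (S n) p = val (S m) p.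
Proof.
move=> /subnK <- Dp; elim: (n - m) => [//|d <-].
have [_ _ [_ eqv _]] := stepS (d + m); apply: eqv.
exact: sub_dom (leq_addl d m) _ Dp.
Qed.

Lemma coverW : W `<=` \bigcup_i ([set` A i] `|` [set` B i]).
Proof.
move=> w Ww; suff /usedP[i _ ABw] : w \in used (S (choice.pickle w).+1).
  by exists i => //; apply/orP.
have [_ _ [[_ covers _]|[sW _]]] := invS (choice.pickle w).+1; last exact: sW.
by apply: covers; rewrite ?timeE.
Qed.

Definition limit_dom : set nat := [set p | exists n, p \in dom (S n)].

(** After more than [lay q] rounds, either the diagonal of [q] is filled or the domain is an initial
    segment containing [p]. *)
Lemma limit_dom_down p q : q <= p -> limit_dom p -> limit_dom q.
Proof.
move=> le_qp [n Dp]; exists (maxn n (lay q).+1).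
have Dp' := sub_dom (leq_maxl n (lay q).+1) Dp.
have [_ _ [[-> _ _]|[_ [N domE]]]] := invS (maxn n (lay q).+1).
  by rewrite timeE leq_maxr.
by move: Dp'; rewrite !domE; apply: leq_trans.
Qed.

Lemma limit_dom0 : limit_dom 0.
Proof.
exists 1; have [_ _ [[-> _ _]|[_ [N ->]]]] := invS 1 => //.
by rewrite timeE /lay div0n mod0n.
Qed.

Lemma limit_spanned : spanned_by_path_power H k (\bigcup_i [set` B i]).
Proof.
(* A value never changes once its position is filled, so the labellings have a limit; positions
   never filled get an arbitrary value. *)
have [v vE] : {v : nat -> V & forall p n, p \in dom (S n) -> val (S n) p = v p}.
  apply: (@choice _ _ (fun p x => forall n, p \in dom (S n) -> val (S n) p = x)) => p.
  have [[n Dp]|NDp] := pselect (limit_dom p); last first.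
    by exists (val (S 0) p) => n Dp; case: NDp; exists n.
  exists (val (S n) p) => m Dp'; case/orP: (leq_total m n) => le_mn.
    by rewrite (val_dom le_mn).
  exact: val_dom.
(* Injectivity and adjacency concern two positions at a time, so they pass to the limit from a stage
   where both are filled. *)
have common p q : limit_dom p -> limit_dom q ->
    exists2 n, p \in dom (S n) & q \in dom (S n).
  move=> [m Dp] [n Dq]; exists (maxn m n); first exact: sub_dom (leq_maxl _ _) _ Dp.
  exact: sub_dom (leq_maxr _ _) _ Dq.
exists limit_dom, v; split.
- exact: down_closed_nat limit_dom0 limit_dom_down.
- split.
  + move=> p [n]; elim: n => [|n IHn Dp]; first by rewrite S0.
    have [/IHn//|NDp] := boolP (p \in dom (S n)).
    exists n => //=; rewrite BE -(vE _ _ Dp); apply: in_imfset.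
    by rewrite /= inE NDp.
  + move=> p q; rewrite !inE => Lp Lq; have [n Dp Dq] := common p q Lp Lq.
    rewrite -(vE _ _ Dp) -(vE _ _ Dq).
    by have [[injv _] _ _] := invS n; apply: injv.
  + move=> x [n _] /=; rewrite BE => /imfsetP[p /=]; rewrite inE => /andP[_ Dp] ->.
    by exists p; [exists n.+1|rewrite (vE _ _ Dp)].
- move=> p q Lp Lq; have [n Dp Dq] := common p q Lp Lq.
  rewrite -(vE _ _ Dp) -(vE _ _ Dq).
  by have [[_ adjv] _ _] := invS n; apply: adjv.
Qed.

End Play.

(** * Assembling the strategy *)

Lemma inv_start c0 : inv (start c0).
Proof. by split=> //; left; split. Qed.

Lemma winning_strategy (c0 : nat -> V) :
  exists sigma : bob_strategy V, winning_for_bob H W k sigma.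
Proof.
have [next nextP] : {next : state * {fset V} -> state &
    forall sA, inv sA.1 -> inv (next sA) /\ step sA.1 sA.2 (next sA)}.
  apply: (@choice _ _ (fun sA s' => inv sA.1 -> inv s' /\ step sA.1 sA.2 s')).
  move=> [s A] /=; have [/(inv_step A)[s' s'P]|NI] := pselect (inv s).
    by exists s'.
  by exists s.
pose run As := foldl (fun s A => next (s, A)) (start c0) As.
(* The states before and after Bob's move are recomputed from Adam's moves, the former by dropping
   the last one. *)
exists (fun As _ => move (run (take (size As).-1 As)) (run As)) => A B followsAB.
pose S n := run (mkseq A n).
have SS n : S n.+1 = next (S n, A n) by rewrite /S mkseqS /run foldl_rcons.
have invS n : inv (S n).
  elim: n => [|n IHn]; first exact: inv_start.
  by rewrite SS; case: (nextP (S n, A n) IHn).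
have stepS n : step (S n) (A n) (S n.+1).
  by rewrite SS; case: (nextP (S n, A n) (invS n)).
have BE n : B n = move (S n) (S n.+1).
  by rewrite followsAB size_mkseq /= {1}mkseqS -cats1 take_size_cat ?size_mkseq.
have S0 : S 0 = start c0 by [].
split=> [n _|_]; first exact: (bob_legal_play S0 stepS BE).
by split; [apply: coverW S0 invS stepS BE|apply: limit_spanned S0 invS stepS BE].
Qed.

End Bob.

Theorem theorem4p5 (V : countType) (V_infinite : infinite_set [set: V])
    (H : sgraph V) (W : set V) (W_nonempty : W !=set0) (k : nat)
    (Ws : nat -> set V) (Ws0 : Ws 0%N = W)
    (Ws_infinite : forall j : nat, (j < k)%N -> forall F : {fset V},
       [set` F] `<=` \bigcup_(i in [set i : nat | (i <= j)%N]) Ws i ->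
       infinite_set (Ws j.+1 `&` common_nbrs H [set` F])) :
  exists sigma : bob_strategy V, winning_for_bob H W k sigma.
Proof.
(* The total labelling of the empty initial path needs some vertex as its value. *)
have [w0 _] := W_nonempty.
exact: winning_strategy V_infinite Ws0 Ws_infinite (fun=> w0).
Qed.
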